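(* Let $G=(V,E)$ be a finite graph with $m=|E|\ge3$ edges, $p\in(0,1)$ and $q\in\mathbb N$. Let $\tilde P_{\rm SW}$ and $P_{\rm SB}$ be the transition matrices of the Swendsen--Wang dynamics and of the single-bond dynamics, respectively, for the random-cluster model on $G$ with parameters $p$ and $q$. Then \[ \lambda(P_{\rm SB})\;\le\;\lambda(\tilde P_{\rm SW})\;\le\;8\,m\log m\;\lambda(P_{\rm SB}). \]
   Context: Graphs are finite, parallel edges and loops allowed; each edge $e$ has endvertices $e^{(1)},e^{(2)}$. For $A\subseteq E$, $c(A)$ is the number of connected components of $(V,A)$, and $u\overset{A}{\leftrightarrow}v$ means $u,v$ are connected in $(V,A)$. For $\sigma\in\{1,\dots,q\}^V$, $E(\sigma)$ is the set of edges whose endvertices have the same color. Random-cluster measure: $\mu(A)\propto\bigl(\tfrac{p}{1-p}\bigr)^{|A|}q^{c(A)}$ on subsets $A\subseteq E$. Swendsen--Wang dynamics for the RC model: $\tilde P_{\rm SW}(A,B)=q^{-c(A)}\bigl(\tfrac{p}{1-p}\bigr)^{|B|}\sum_{\sigma\in\{1,\dots,q\}^V}(1-p)^{|E(\sigma)|}\mathbf 1(A\cup B\subseteq E(\sigma))$ (color each component of $(V,A)$ independently uniformly, then keep each edge of $E(\sigma)$ independently with probability $p$). Single-bond dynamics: $P_{\rm SB}(A,B)=\frac1{|E|}\sum_{e\in E}g_e(A,B)$ where $g_e(A,B)=p$ if $B=A\cup\{e\}$ and $e^{(1)}\overset{A}{\leftrightarrow}e^{(2)}$; $1-p$ if $B=A\setminus\{e\}$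 and $e^{(1)}\overset{A}{\leftrightarrow}e^{(2)}$; $p/q$ if $B=A\cup\{e\}$ and $e^{(1)},e^{(2)}$ are not connected in $(V,A)$; $1-p/q$ if $B=A\setminus\{e\}$ and they are not connected; $0$ otherwise. Both are reversible w.r.t. $\mu$. Spectral gap: $\lambda(P)=1-\max\{|\xi|:\xi\text{ eigenvalue of }P,\ \xi\neq1\}$; $\log$ is the natural logarithm. *)

(* Defs.v *)
From HB Require Import structures.
From mathcomp Require Import all_boot all_order all_algebra.
From mathcomp Require Import all_classical all_reals all_analysis.
Set Implicit Arguments. Unset Strict Implicit. Unset Printing Implicit Defensive.
Import Order.TTheory GRing.Theory Num.Theory.
Local Open Scope ring_scope.
Local Open Scope classical_set_scope.

Section Graph.
(* A finite multigraph: vertex type V, edge type E, endpoints e1 e, e2 e.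
   Loops and parallel edges are allowed. *)
Variables (V E : finType) (e1 e2 : E -> V).

Definition adjA (A : {set E}) : rel V :=
  fun u v => [exists e in A, ((e1 e == u) && (e2 e == v)) || ((e1 e == v) && (e2 e == u))].

Definition conn (A : {set E}) (u v : V) : bool := connect (adjA A) u v.

Definition ncomp (A : {set E}) : nat := n_comp (adjA A) V.

Definition mono_edges (q : nat) (sigma : {ffun V -> 'I_q}) : {set E} :=
  [set e | sigma (e1 e) == sigma (e2 e)].

Variable R : realType.

Definition P_SW (p : R) (q : nat) (A B : {set E}) : R :=
  (q%:R ^- ncomp A) * (p / (1 - p)) ^+ #|B| *
  \sum_(sigma : {ffun V -> 'I_q})
     (1 - p) ^+ #|mono_edges sigma| *
     (if (A :|: B) \subset mono_edges sigma then 1 else 0).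

Definition g_e (p : R) (q : nat) (e : E) (A B : {set E}) : R :=
  if conn A (e1 e) (e2 e) then
    (if B == e |: A then p else if B == A :\ e then 1 - p else 0)
  else
    (if B == e |: A then p / q%:R else if B == A :\ e then 1 - p / q%:R else 0).

Definition P_SB (p : R) (q : nat) (A B : {set E}) : R :=
  (#|E|%:R)^-1 * \sum_(e : E) g_e p q e A B.

End Graph.

Definition kmx (R : realType) (S : finType) (P : S -> S -> R) : 'M[R]_#|S| :=
  \matrix_(i < #|S|, j < #|S|) P (enum_val i) (enum_val j).

(* Spectral gap: 1 - max{ |xi| : xi eigenvalue of P, xi <> 1 }.
   The eigenvalue set is finite, so the sup is a max when nonempty. *)
Definition spectral_gap (R : realType) (S : finType) (P : S -> S -> R) : R :=
  1 - sup [set `|xi| | xi in [set xi : R | eigenvalue (kmx P) xi && (xi != 1)]].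

(* Main.v *)
(* Both dynamics are mixtures over the colourings sigma of operators on L2 of
   the product Bernoulli(p) measure on the subsets of E(sigma): Swendsen-Wang
   replaces f by its mean, single-bond averages the resamplings T_e of one edge.
   The T_e are commuting orthogonal projections whose product is the mean, so
     E[f]^2 <= <f, T_e f>   and   Var f <= sum_e (<f, f> - <f, T_e f>)
   (the second is the Efron-Stein inequality). Integrating over sigma compares
   the Dirichlet forms of the two chains in both directions, and since both
   chains are reversible for the same measure and positive semidefinite, the
   gaps compare in the same way. This gives the upper bound even with m in place
   of 8 m log m. *)
Require Import Defs.
From HB Require Import structures.
From mathcomp Require Import all_boot all_order all_algebra.
From mathcomp Require Import all_classical all_reals all_analysis.
From mathcomp Require Import ring lra.
Import Order.TTheory GRing.Theory Num.Theory.
Import numFieldNormedType.Exports.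
Local Open Scope ring_scope.

(** * Spectral gaps of reversible kernels *)

Section WeightedForm.
Variables (R : realType) (S : finType) (mu : S -> R).

Definition wdot (f g : S -> R) : R := \sum_s mu s * (f s * g s).
Definition act (P : S -> S -> R) (f : S -> R) (s : S) : R := \sum_t P s t * f t.

Lemma wdotC f g : wdot f g = wdot g f.
Proof. by apply: eq_bigr => s _; rewrite (mulrC (f s)). Qed.

Lemma wdotDZl t f g h :
  wdot (fun s => f s + t * g s) h = wdot f h + t * wdot g h.
Proof.
by rewrite /wdot mulr_sumr -big_split /=; apply: eq_bigr => s _; ring.
Qed.

Lemma wdotDZr t f g h :
  wdot h (fun s => f s + t * g s) = wdot h f + t * wdot h g.
Proof. by rewrite wdotC wdotDZl !(wdotC h). Qed.

Lemma wdotZr t f g : wdot f (fun s => t * g s) = t * wdot f g.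
Proof. by rewrite /wdot mulr_sumr; apply: eq_bigr => s _; ring. Qed.

Lemma wdot_deltal a f : wdot (fun s => (s == a)%:R) f = mu a * f a.
Proof.
rewrite /wdot (bigD1 a) //= eqxx mul1r big1 ?addr0 // => t /negPf ->.
by rewrite mul0r mulr0.
Qed.

Lemma wdot_ge0 f : (forall s, 0 <= mu s) -> 0 <= wdot f f.
Proof.
by move=> mu0; apply: sumr_ge0 => s _; rewrite mulr_ge0 -?expr2 ?sqr_ge0.
Qed.

Lemma wdot_eq0 f : (forall s, 0 < mu s) -> wdot f f = 0 -> forall s, f s = 0.
Proof.
move=> mu0 f0 s; have ge0 t : 0 <= mu t * (f t * f t).
  by rewrite mulr_ge0 -?expr2 ?sqr_ge0// ltW.
by have /eqP := psumr_eq0P (fun t (_ : true) => ge0 t) f0 (i := s) isT;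
  rewrite mulf_eq0 (gt_eqF (mu0 s)) /= mulf_eq0 orbb => /eqP.
Qed.

Lemma actDZ P t f g s :
  act P (fun s => f s + t * g s) s = act P f s + t * act P g s.
Proof.
by rewrite /act mulr_sumr -big_split /=; apply: eq_bigr => i _; ring.
Qed.

(** Detailed balance is encoded as self-adjointness in L2(mu), which can be read off directly from a
    symmetric formula for the bilinear form. The weight [mu] is not normalised. *)
Definition kreversible (P : S -> S -> R) :=
  forall f g, wdot f (act P g) = wdot (act P f) g.

End WeightedForm.
Arguments wdot {R S}.
Arguments act {R S}.
Arguments kreversible {R S}.

Section ReversibleKernel.
Variables (R : realType) (S : finType) (mu : S -> R).
Hypothesis mu_gt0 : forall s, 0 < mu s.
Let mu_ge0 s : 0 <= mu s := ltW (mu_gt0 s).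
Local Notation wdot := (wdot mu).
Local Notation kreversible := (kreversible mu).
Implicit Types (P Q : S -> S -> R) (f g : S -> R).

Lemma act_delta P a s : act P (fun t => (t == a)%:R) s = P s a.
Proof.
rewrite /act (bigD1 a) //= eqxx mulr1 big1 ?addr0 // => t /negPf ->.
by rewrite mulr0.
Qed.

Lemma kreversibleE P : kreversible P ->
  forall a b, mu a * P a b = mu b * P b a.
Proof.
move=> revP a b.
have := revP (fun t => (t == a)%:R) (fun t => (t == b)%:R).
by rewrite [RHS]wdotC !wdot_deltal !act_delta.
Qed.

(* MathComp's eigenvectors are row vectors: dividing one by [mu] gives an
   eigenfunction of the reversible kernel. *)
Lemma eigenvalue_kmxP P x : kreversible P ->
  (exists2 f, 0 < wdot f f & forall s, act P f s = x * f s) <->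
  eigenvalue (kmx P) x.
Proof.
move=> /kreversibleE revP.
have reidx (F : S -> R) : \sum_s F s = \sum_(i < #|S|) F (enum_val i).
  by rewrite (reindex (@enum_val S predT)) //; apply: onW_bij; exact: enum_val_bij.
split=> [[f f0 Pf]|/eigenvalueP[v vP v0]].
  apply/eigenvalueP; exists (\row_i (mu (enum_val i) * f (enum_val i))).
    apply/rowP => j; rewrite !mxE mulrCA -Pf /act mulr_sumr reidx.
    by apply: eq_bigr => i _; rewrite !mxE mulrAC revP; ring.
  apply: contraTneq f0 => /rowP v0; rewrite -leNgt /wdot big1 // => s _.
  by have := v0 (enum_rank s); rewrite !mxE enum_rankK mulrA => ->; rewrite mul0r.
exists (fun s => v ord0 (enum_rank s) / mu s).
  rewrite lt_def (wdot_ge0 _ _ _ _ mu_ge0) andbT.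
  apply: contra v0 => /eqP/(wdot_eq0 _ _ _ _ mu_gt0) f0.
  apply/eqP/rowP => i; have /eqP := f0 (enum_val i).
  by rewrite enum_valK mulf_eq0 invr_eq0 (gt_eqF (mu_gt0 _)) orbF mxE => /eqP.
move=> s; have /rowP/(_ (enum_rank s)) := vP.
rewrite !mxE mulrA => <-; rewrite mulr_suml /act reidx; apply: eq_bigr => i _.
rewrite mxE enum_rankK enum_valK.
apply: (mulfI (lt0r_neq0 (mu_gt0 s))); rewrite mulrA revP.
field; by rewrite !gt_eqF.
Qed.

(** * Continuity of the forms and compactness of the unit sphere *)

Lemma mul_fun_continuous (T : topologicalType) (f g : T -> R) :
  continuous f -> continuous g -> continuous (fun x => f x * g x).
Proof. by move=> fc gc x; apply: cvgM; [exact: fc|exact: gc]. Qed.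

Lemma sum_fun_continuous (T : topologicalType) (F : S -> T -> R) :
  (forall s, continuous (F s)) -> continuous (fun x => \sum_s F s x).
Proof. by move=> Fc; apply: continuous_big => //; exact: add_continuous. Qed.

Lemma eval_continuous s : continuous (fun f : {ptws S -> R} => f s).
Proof. exact: (@proj_continuous S (fun=> R) s). Qed.

Lemma wdot_continuous (T : topologicalType) (F G : T -> S -> R) :
  (forall s, continuous (fun x => F x s)) ->
  (forall s, continuous (fun x => G x s)) ->
  continuous (fun x => wdot (F x) (G x)).
Proof.
move=> Fc Gc; apply: (sum_fun_continuous T (fun s x => mu s * (F x s * G x s))) => s.
apply: (mul_fun_continuous T (fun=> mu s)); first exact: cst_continuous.
exact: (mul_fun_continuous T (F^~ s) (G^~ s)).
Qed.

Lemma act_continuous (P : S -> S -> R) s :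
  continuous (fun f : {ptws S -> R} => act P f s).
Proof.
apply: (sum_fun_continuous {ptws S -> R} (fun t f => P s t * f t)) => t.
apply: (mul_fun_continuous {ptws S -> R} (fun=> P s t)); first exact: cst_continuous.
exact: eval_continuous.
Qed.

Lemma closed_level_set (T : topologicalType) (f : T -> R) c :
  continuous f -> closed [set x | f x = c]%classic.
Proof. by move=> /continuous_closedP fc; exact: (fc _ (@closed_eq _ c)). Qed.

Lemma compact_unit_sphere :
  compact [set f : {ptws S -> R} | wdot (fun=> 1) f = 0 /\ wdot f f = 1].
Proof.
pose box : set {ptws S -> R} :=
  [set f : {ptws S -> R} |
    forall s, `[- (1 + (mu s)^-1), 1 + (mu s)^-1]%classic (f s)]%classic.
apply: (@subclosed_compact _ _ box).
- apply: closedI.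
    apply: (closed_level_set {ptws S -> R} (fun f => wdot (fun=> 1) f)).
    apply: (wdot_continuous {ptws S -> R} (fun _ _ => 1) id) => s.
      exact: cst_continuous.
    exact: eval_continuous.
  apply: (closed_level_set {ptws S -> R} (fun f => wdot f f)).
  by apply: (wdot_continuous {ptws S -> R} id id) => s; exact: eval_continuous.
- apply: (@tychonoff S (fun=> R)
    (fun s => `[- (1 + (mu s)^-1), 1 + (mu s)^-1]%classic)) => s.
  exact: segment_compact.
move=> f [_ f1] s /=; rewrite in_itv /= -ler_norml.
(* One term of the sum equal to 1 bounds each coordinate: x^2 <= a gives |x| <= 1 + a, whence the
   side of the box. *)
have fs : mu s * (f s * f s) <= 1.
  rewrite -f1 /wdot (bigD1 s) //= lerDl; apply: sumr_ge0 => t _.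
  by rewrite mulr_ge0 -?expr2 ?sqr_ge0// ltW.
have {}fs : `|f s| ^+ 2 <= (mu s)^-1.
  by rewrite real_normK ?num_real // expr2 -(ler_pM2l (mu_gt0 s)) mulfV ?gt_eqF.
have : 0 <= `|f s| by [].
by nra.
Qed.

(** * The variational principle and the comparison of gaps *)

Lemma act_cst P c : (forall s, \sum_t P s t = 1) ->
  act P (fun=> c) = fun=> c.
Proof. by move=> P1; apply/funext => s; rewrite /act -mulr_suml P1 mul1r. Qed.

(** This stands in for the spectral theorem: by compactness the quadratic form of [P] attains its
    maximum on the unit sphere orthogonal to the constants, and a maximizer is an eigenfunction. *)
Lemma rayleigh P f : kreversible P -> (forall s, \sum_t P s t = 1) ->
    wdot (fun=> 1) f = 0 -> 0 < wdot f f ->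
  exists g y, [/\ wdot (fun=> 1) g = 0, 0 < wdot g g,
    forall s, act P g s = y * g s & wdot f (act P f) <= y * wdot f f].
Proof.
move=> revP P1.
pose K := [set f : {ptws S -> R} | wdot (fun=> 1) f = 0 /\ wdot f f = 1]%classic.
have actZ t h s : act P (fun s => t * h s) s = t * act P h s.
  by rewrite /act mulr_sumr; apply: eq_bigr => i _; ring.
have normalize h : wdot (fun=> 1) h = 0 -> 0 < wdot h h ->
    K (fun s => (Num.sqrt (wdot h h))^-1 * h s).
  move=> h1 h0; rewrite /K /= wdotZr h1 mulr0 wdotZr wdotC wdotZr; split=> //.
  rewrite mulrA -expr2 exprVn sqr_sqrtr ?ltW //.
  by rewrite mulVf ?gt_eqF.
move=> f1 f0.
have [|g /set_mem [g1 gg] gmax] := compact_EVT_max (ex_intro _ _ (normalize f f1 f0))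
  compact_unit_sphere (f := fun f : {ptws S -> R} => wdot f (act P f)).
  apply: continuous_subspaceT; apply: (wdot_continuous {ptws S -> R} id (act P)) => s.
    exact: eval_continuous.
  exact: act_continuous.
set y := wdot g (act P g) in gmax.
(* Homogeneity extends the maximality of [g] from the unit sphere to all [h] orthogonal to the
   constants. *)
have rq h : wdot (fun=> 1) h = 0 -> wdot h (act P h) <= y * wdot h h.
  move=> h1; have [/eqP h0|h0] := eqVneq 0 (wdot h h).
    have hs := wdot_eq0 _ _ _ h mu_gt0 (esym (eqP h0)).
    rewrite -(eqP h0) mulr0 /wdot big1 // => s _.
    by rewrite hs mul0r mulr0.
  have {}h0 : 0 < wdot h h by rewrite lt_def eq_sym h0 (wdot_ge0 _ _ _ _ mu_ge0).
  have := gmax _ (mem_set (normalize h h1 h0)).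
  set c := (Num.sqrt _)^-1.
  have c2 : c ^+ 2 = (wdot h h)^-1 by rewrite exprVn sqr_sqrtr ?ltW.
  have -> : act P (fun s => c * h s) = fun s => c * act P h s.
    by apply/funext => s; rewrite actZ.
  rewrite wdotZr wdotC wdotZr (wdotC _ _ _ _ h) mulrA -expr2 c2.
  by rewrite mulrC ler_pdivrMr.
(* Perturbing the maximizer [g] of the Rayleigh quotient in the direction of its
   defect [w] would increase the quotient unless [w] vanishes. *)
pose w := fun s => act P g s + (- y) * g s.
have w1 : wdot (fun=> 1) w = 0.
  by rewrite /w wdotDZr revP act_cst // g1 mulr0 addr0.
have ww : wdot w w = 0.
  apply/eqP; rewrite eq_le (wdot_ge0 _ _ _ _ mu_ge0) andbT leNgt; apply/negP => w0.
  have wE : wdot w w = wdot w (act P g) - y * wdot w g.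
    by rewrite {2}/w wdotDZr mulNr.
  clearbody w.
  pose c := wdot w (act P w) - y * wdot w w.
  have c0 : c <= 0 by rewrite subr_le0 rq.
  have c10 : 0 < 1 - c by lra.
  (* With a = <w, w>, maximality tested on g + t w reads t (2a + t c) <= 0. This [t] gives t c = t -
     a, so the bracket equals a + t > 0, a contradiction. *)
  pose t := wdot w w / (1 - c).
  have t0 : 0 < t by rewrite divr_gt0.
  have tc : t * (1 - c) = wdot w w by rewrite /t divfK ?gt_eqF.
  have := rq (fun s => g s + t * w s).
  rewrite wdotDZr g1 w1 mulr0 addr0 => /(_ erefl).
  have -> : act P (fun s => g s + t * w s) = fun s => act P g s + t * act P w s.
    by apply/funext => s; rewrite actDZ.
  rewrite !wdotDZr !wdotDZl -/y gg (revP g w) (wdotC _ _ _ (act P g)) (wdotC _ _ _ g w).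
  move: c0 tc w0 wE; rewrite /c.
  set a := wdot w w; set b := wdot w (act P w); set d := wdot w (act P g).
  set e := wdot w g; clearbody a b d e t => c0 tc w0 ad H.
  have : t * (2 * a + t * (b - y * a)) <= 0 by rewrite ad; rewrite ad in H; nra.
  by rewrite pmulr_rle0 //; lra.
exists g, y; split => //; last exact: rq.
  by rewrite gg.
move=> s; have /eqP := wdot_eq0 _ _ _ _ mu_gt0 ww s.
by rewrite addr_eq0 mulNr opprK => /eqP.
Qed.

(** An eigenfunction f of [Q] for y <> 1 is orthogonal to the constants, so [rayleigh] yields an
    eigenvalue z of [P] with <f, P f> <= z <f, f>. Irreducibility makes z <> 1, so z counts in the
    gap of [P], and the form inequality gives 1 - z <= K (1 - y). Positivity removes the absolute
    values. *)
Lemma gap_comparison P Q K :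
  kreversible P -> kreversible Q ->
  (forall s, \sum_t P s t = 1) -> (forall s, \sum_t Q s t = 1) ->
  (forall f, 0 <= wdot f (act P f) <= wdot f f) ->
  (forall f, 0 <= wdot f (act Q f)) ->
  (forall f, wdot (fun=> 1) f = 0 -> wdot f (act P f) = wdot f f -> wdot f f = 0) ->
  1 <= K ->
  (forall f, wdot f f - wdot f (act P f) <= K * (wdot f f - wdot f (act Q f))) ->
  spectral_gap P <= K * spectral_gap Q.
Proof.
move=> revP revQ P1 Q1 boundP posQ irrP K1 PQ; rewrite /spectral_gap.
set setP := [set `|x| | x in _]%classic; set setQ := [set `|x| | x in _]%classic.
have evw T f x : (forall s, act T f s = x * f s) ->
    forall h, wdot h (act T f) = x * wdot h f.
  by move=> /funext Tf h; rewrite Tf wdotZr.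
have ubP : has_ubound setP.
  exists 1 => _ [x /andP[/(eigenvalue_kmxP P x revP)[f f0 Pf] _] <-].
  have := boundP f; rewrite (evw _ _ _ Pf) => /andP[].
  rewrite pmulr_lge0 // => x0; rewrite -{2}[wdot f f]mul1r ler_pM2r //.
  by rewrite ger0_norm.
have supP0 : 0 <= sup setP.
  have [[z Pz]|/set0P/negP/negPn/eqP->] := pselect (setP !=set0)%classic; last first.
    by rewrite sup0.
  apply: (@le_trans _ _ z); last by apply: sup_upper_bound => //; split => //; exists z.
  by case: Pz => x _ <-.
have K0 : 0 < K by lra.
suff : sup setQ <= 1 - (1 - sup setP) / K.
  by rewrite -(ler_pM2l K0) mulrBr mulrBr mulr1 [K * (_ / K)]mulrC divfK ?gt_eqF //; lra.
(* Needed when [Q] has no eigenvalue other than 1: then [sup] of the empty set is 0 and the gap of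
   [Q] is 1. The assumption 1 <= K enters here. *)
have lebound : (1 - sup setP) / K <= 1 by rewrite ler_pdivrMr //; lra.
have [Q0|/set0P/negP/negPn/eqP->] := pselect (setQ !=set0)%classic; last first.
  by rewrite sup0 subr_ge0.
apply: ge_sup => // _ [y /andP[/(eigenvalue_kmxP Q y revQ)[f f0 Qf] y1] <-].
have f1 : wdot (fun=> 1) f = 0.
  have := evw _ _ _ Qf (fun=> 1); rewrite revQ act_cst // => /eqP.
  rewrite -subr_eq0 -{1}[wdot _ f]mul1r -mulrBl mulf_eq0 subr_eq0 eq_sym.
  by rewrite (negPf y1) => /eqP.
have y0 : 0 <= y.
  by have := posQ f; rewrite (evw _ _ _ Qf) pmulr_lge0.
rewrite ger0_norm //.
have [g [z [g1 g0 Pg zf]]] := rayleigh P f revP P1 f1 f0.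
have z1 : z != 1.
  apply/eqP => z1; have := irrP g g1; rewrite (evw _ _ _ Pg) z1 mul1r => /(_ erefl).
  by move: g0 => /[swap] ->; rewrite ltxx.
have : z <= sup setP.
  apply: (@le_trans _ _ `|z|); first exact: ler_norm.
  apply: sup_upper_bound; last first.
    by exists z => //=; rewrite z1 andbT; apply/(eigenvalue_kmxP P z revP); exists g.
  split => //; exists `|z|; exists z => //=.
  by rewrite z1 andbT; apply/(eigenvalue_kmxP P z revP); exists g.
move=> zs; rewrite lerBrDl -lerBrDr ler_pdivrMr //.
have := PQ f; rewrite (evw _ _ _ Qf) => PQf.
rewrite -(ler_pM2r f0); apply: le_trans (_ : wdot f f - wdot f (act P f) <= _).
  by rewrite mulrBl mul1r lerD2l lerN2 (le_trans zf) // ler_pM2r.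
by apply: le_trans PQf _; rewrite -{1}[wdot f f]mul1r -mulrBl mulrA [K * _]mulrC.
Qed.

End ReversibleKernel.

(** * Resampling under a product Bernoulli measure *)

Section BernoulliMeasure.
Variables (R : realType) (E : finType) (pe : E -> R).
Hypothesis pe01 : forall e, 0 <= pe e <= 1.
Implicit Types (A B : {set E}) (f g h : {set E} -> R) (e : E) (s : seq E).

Definition bernoulli A : R := \prod_e (if e \in A then pe e else 1 - pe e).
(** Conditional expectation of [f] given the state of all edges other than [e]. *)
Definition resample e f A : R := pe e * f (e |: A) + (1 - pe e) * f (A :\ e).
Local Notation dot := (wdot bernoulli).

Lemma bernoulli_ge0 A : 0 <= bernoulli A.
Proof.
by apply: prodr_ge0 => e _; case: ifP => _; have /andP[] := pe01 e; rewrite ?subr_ge0.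
Qed.

Lemma bernoulli_sum : \sum_A bernoulli A = 1.
Proof.
transitivity (\prod_e (pe e + (1 - pe e))); first by rewrite bigA_distr.
by rewrite big1 // => e _; rewrite addrC subrK.
Qed.

Lemma sum_setU1 (F : {set E} -> R) e :
  \sum_A F A = \sum_(A : {set E} | e \notin A) (F (e |: A) + F A).
Proof.
rewrite (bigID (fun A : {set E} => e \in A)) /= big_split /=; congr (_ + _).
rewrite (reindex_onto (fun A => e |: A) (fun A => A :\ e)) /=.
  apply: eq_bigl => A; rewrite setU11 /=; apply/eqP/idP => [<-|/setU1K //].
  by rewrite setD11.
by move=> A eA; rewrite finset.setD1K.
Qed.

(** Pairing the edge sets that differ only at [e] produces an expression symmetric in [f] and [g],
    hence self-adjointness of [resample e]. *)
Lemma wdot_resample e f g :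
  dot f (resample e g) = \sum_(A : {set E} | e \notin A)
    (\prod_(e' | e' != e) (if e' \in A then pe e' else 1 - pe e')) *
    ((pe e * f (e |: A) + (1 - pe e) * f A) *
     (pe e * g (e |: A) + (1 - pe e) * g A)).
Proof.
rewrite /wdot (sum_setU1 _ e); apply: eq_bigr => A eA.
have AU : (e |: A) :\ e = A by rewrite setU1K.
have AD : A :\ e = A by apply/finset.setDidPl; rewrite disjoint_sym disjoints1.
have eAU : e |: (e |: A) = e |: A by rewrite finset.setUA finset.setUid.
have bD B : bernoulli B = (if e \in B then pe e else 1 - pe e) *
    \prod_(e' | e' != e) (if e' \in B then pe e' else 1 - pe e').
  by rewrite /bernoulli (bigD1 e).
rewrite /resample AU AD eAU !bD setU11 (negPf eA).
rewrite (eq_bigr (fun e' => if e' \in A then pe e' else 1 - pe e')); last first.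
  by move=> e' /negPf ne; rewrite !inE ne.
ring.
Qed.

Lemma resampleC e f g : dot f (resample e g) = dot (resample e f) g.
Proof.
by rewrite [RHS]wdotC !wdot_resample; apply: eq_bigr => A _; ring.
Qed.

Lemma resample_setU1 e f A : resample e f (e |: A) = resample e f A.
Proof.
rewrite /resample finset.setUA finset.setUid; congr (_ + _ * f _).
by apply/setP => x; rewrite !inE; case: eqP.
Qed.

Lemma resample_setD1 e f A : resample e f (A :\ e) = resample e f A.
Proof.
rewrite /resample finset.setDDl finset.setUid; congr (_ * f _ + _).
by apply/setP => x; rewrite !inE; case: eqP.
Qed.

Lemma resample_id e f : resample e (resample e f) = resample e f.
Proof.
apply/funext => A; rewrite {1}/resample resample_setU1 resample_setD1.
by rewrite -mulrDl addrC subrK mul1r.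
Qed.

Lemma resample_comm e e' f :
  resample e (resample e' f) = resample e' (resample e f).
Proof.
have [->//|ne] := eqVneq e e'; apply/funext => A; rewrite /resample.
have -> : e' |: (e |: A) = e |: (e' |: A) by rewrite finset.setUCA.
have -> : (e |: A) :\ e' = e |: (A :\ e').
  by apply/setP => x; rewrite !inE; have [->|] := eqVneq x e; rewrite ?ne ?(negPf ne).
have -> : e' |: (A :\ e) = (e' |: A) :\ e.
  by apply/setP => x; rewrite !inE; have [->|] := eqVneq x e; rewrite ?ne ?(negPf ne).
have -> : (A :\ e') :\ e = (A :\ e) :\ e' by rewrite !finset.setDDl finset.setUC.
ring.
Qed.

Lemma resampleB e f g :
  resample e (fun A => f A + -1 * g A) =
  fun A => resample e f A + -1 * resample e g A.
Proof. by apply/funext => A; rewrite /resample; ring. Qed.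

Lemma wdot_resample_id e f : dot f (resample e f) = dot (resample e f) (resample e f).
Proof. by rewrite -[in LHS](resample_id e f) resampleC. Qed.

(** Since T_e is an orthogonal projection, so is I - T_e, and <f, (I - T_e) f> is a squared norm. *)
Lemma resample_defect e f :
  dot f f - dot f (resample e f) =
  dot (fun A => f A + -1 * resample e f A) (fun A => f A + -1 * resample e f A).
Proof.
rewrite (wdotDZr _ _ _ (-1) f (resample e f)) !(wdotDZl _ _ _ (-1) f (resample e f)).
by rewrite (wdotC _ _ _ (resample e f) f) -wdot_resample_id; ring.
Qed.

Lemma wdot_resample_bounds e f : 0 <= dot f (resample e f) <= dot f f.
Proof.
rewrite {1}wdot_resample_id wdot_ge0 /=; last exact: bernoulli_ge0.
by rewrite -subr_ge0 resample_defect wdot_ge0 //; exact: bernoulli_ge0.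
Qed.

(** * Successive resamplings and the Efron-Stein inequality *)

Definition resample_seq s f := foldr resample f s.

Lemma resample_seq_comm s e f :
  resample_seq s (resample e f) = resample e (resample_seq s f).
Proof. by elim: s => //= e' s ->; rewrite resample_comm. Qed.

Lemma resample_seqB s f g :
  resample_seq s (fun A => f A + -1 * g A) =
  fun A => resample_seq s f A + -1 * resample_seq s g A.
Proof. by elim: s => //= e' s ->; rewrite resampleB. Qed.

Lemma resample_seq_contract s f :
  dot (resample_seq s f) (resample_seq s f) <= dot f f.
Proof.
elim: s => //= e s; apply: le_trans.
by rewrite -wdot_resample_id; case/andP: (wdot_resample_bounds e (resample_seq s f)).
Qed.

Lemma resample_seq_absorb s e f : e \in s ->
  resample_seq s (resample e f) = resample_seq s f.
Proof.
elim: s => //= e' s IH; rewrite inE => /orP[/eqP <-|/IH ->//].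
by rewrite resample_seq_comm resample_id.
Qed.

(** Let S be the product of the projections already applied. Adding T_e loses |(I - T_e) S f|^2 = |S
    (I - T_e) f|^2 by commutation, and S is a contraction. *)
Lemma resample_seq_telescope s f :
  dot f f - dot (resample_seq s f) (resample_seq s f) <=
  \sum_(e <- s) (dot f f - dot f (resample e f)).
Proof.
elim: s => [|e s IH] /=; first by rewrite big_nil subrr.
rewrite big_cons; set h := resample_seq s f in IH *.
have -> : dot f f - dot (resample e h) (resample e h) =
    (dot h h - dot h (resample e h)) + (dot f f - dot h h).
  by rewrite wdot_resample_id; ring.
apply: lerD IH; rewrite !resample_defect.
have -> : (fun A => h A + -1 * resample e h A) =
    resample_seq s (fun A => f A + -1 * resample e f A).
  by rewrite resample_seqB resample_seq_comm.
exact: resample_seq_contract.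
Qed.

Lemma setU1_invariant_cst f :
  (forall e A, f (e |: A) = f A) -> forall A, f A = f finset.set0.
Proof.
move=> fU A; rewrite -[A](set_enum A); elim: (enum A) => [|e s IH].
  by congr f; apply/setP => x; rewrite !inE.
by rewrite set_cons fU.
Qed.

Lemma resample1 e : resample e (fun=> 1) = fun=> 1.
Proof. by apply/funext => A; rewrite /resample !mulr1 addrC subrK. Qed.

Lemma wdot1_resample_seq s f : dot (fun=> 1) (resample_seq s f) = dot (fun=> 1) f.
Proof. by elim: s => //= e s <-; rewrite resampleC resample1. Qed.

(** Resampling every edge leaves a function insensitive to each edge, hence constant. The constant
    is the mean, because each T_e is self-adjoint and fixes 1. *)
Lemma wdot_resample_enum f :
  dot (resample_seq (index_enum E) f) (resample_seq (index_enum E) f) =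
  dot (fun=> 1) f ^+ 2.
Proof.
rewrite -(wdot1_resample_seq (index_enum E)); set h := resample_seq _ f.
have hU e A : h (e |: A) = h A.
  rewrite /h -(resample_seq_absorb _ e) ?mem_index_enum //.
  by rewrite resample_seq_comm resample_setU1.
have -> : h = fun=> h finset.set0 by apply/funext; exact: setU1_invariant_cst.
by rewrite /wdot -!mulr_suml bernoulli_sum !mul1r expr2.
Qed.

Lemma efron_stein f :
  dot f f - dot (fun=> 1) f ^+ 2 <= \sum_e (dot f f - dot f (resample e f)).
Proof. by rewrite -wdot_resample_enum; exact: resample_seq_telescope. Qed.

(** The full product S absorbs T_e, so the squared mean is |S T_e f|^2 <= |T_e f|^2 = <f, T_e f>. *)
Lemma resample_jensen e f : dot (fun=> 1) f ^+ 2 <= dot f (resample e f).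
Proof.
rewrite -wdot_resample_enum -(resample_seq_absorb _ e) ?mem_index_enum //.
by rewrite wdot_resample_id; exact: resample_seq_contract.
Qed.

End BernoulliMeasure.

(** * Counting colourings *)

Section Colourings.
Variables (V E : finType) (e1 e2 : E -> V) (q : nat).
Implicit Types (A : {set E}) (sigma tau : {ffun V -> 'I_q}).

Lemma adjA_sym A : symmetric (adjA e1 e2 A).
Proof. by move=> u v; apply: eq_existsb => e; rewrite orbC. Qed.

Lemma connA_sym A : connect_sym (adjA e1 e2 A).
Proof. exact: (sym_connect_sym (adjA_sym A)). Qed.

Lemma mono_edgesP A sigma :
  reflect (forall u v, conn e1 e2 A u v -> sigma u = sigma v)
          (A \subset mono_edges e1 e2 sigma).
Proof.
apply: (iffP fintype.subsetP) => [Asub u v /connectP[s]|Aconn e eA].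
  elim: s u => [|w s IH] u /= => [_ -> //|/andP[/existsP[e /andP[eA uw]] sP vE]].
  rewrite -(IH _ sP vE); have := Asub e eA; rewrite inE => /eqP.
  by case/orP: uw => /andP[/eqP<- /eqP<-].
rewrite inE; apply/eqP/Aconn/connect1/existsP; exists e.
by rewrite eA !eqxx.
Qed.

(** A compatible colouring amounts to a free choice of colour at the root of each component; [ext]
    spreads that choice over the components. *)
Lemma card_colourings A :
  #|[pred sigma : {ffun V -> 'I_q} | A \subset mono_edges e1 e2 sigma]| =
  (q ^ ncomp e1 e2 A)%N.
Proof.
pose r := fingraph.root (adjA e1 e2 A).
have rr v : fingraph.roots (adjA e1 e2 A) (r v) := fingraph.roots_root (connA_sym A) v.
pose sT := {v : V | fingraph.roots (adjA e1 e2 A) v}.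
pose ext (tau : {ffun sT -> 'I_q}) : {ffun V -> 'I_q} :=
  [ffun v => tau (Sub (r v) (rr v))].
have ext_inj : injective ext.
  move=> t t' /ffunP tt; apply/ffunP => x; have := tt (val x); rewrite !ffunE.
  suff -> : Sub (r (val x)) (rr (val x)) = x by [].
  by apply: val_inj => /=; apply/eqP; exact: (valP x).
have -> : (q ^ ncomp e1 e2 A = #|{ffun sT -> 'I_q}|)%N.
  rewrite card_ffun card_ord card_sig; congr (q ^ _)%N.
  by apply: eq_card => v; rewrite !inE andbT.
rewrite -(card_codom ext_inj); apply: eq_card => sigma; rewrite inE.
apply/mono_edgesP/codomP => [mono|[t ->] u v].
  exists [ffun x : sT => sigma (val x)]; apply/ffunP => v; rewrite !ffunE /=.
  by apply: mono; exact: connect_root.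
rewrite !ffunE => /(fingraph.rootP (connA_sym A)) ruv.
by congr (t _); apply: val_inj.
Qed.

(** * Recolouring one component *)

Definition recolour A u (c : 'I_q) sigma : {ffun V -> 'I_q} :=
  [ffun w => if conn e1 e2 A u w then c else sigma w].

Lemma recolour_mono A u c sigma :
  A \subset mono_edges e1 e2 sigma ->
  A \subset mono_edges e1 e2 (recolour A u c sigma).
Proof.
move=> /mono_edgesP mono; apply/mono_edgesP => v w vw; rewrite !ffunE.
have -> : conn e1 e2 A u v = conn e1 e2 A u w.
  by rewrite /conn (same_connect_r (connA_sym A) vw).
by case: ifP => // _; exact: mono.
Qed.

Lemma recolourK A u c c' sigma :
  recolour A u c (recolour A u c' sigma) = recolour A u c sigma.
Proof. by apply/ffunP => w; rewrite !ffunE; case: (conn _ _ _ _ _). Qed.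

Lemma recolour_id A u sigma : A \subset mono_edges e1 e2 sigma ->
  recolour A u (sigma u) sigma = sigma.
Proof.
move=> /mono_edgesP mono; apply/ffunP => w; rewrite ffunE.
by case: ifP => // /mono.
Qed.

(* Recolouring the component of [u] identifies the colourings giving [u] the
   colour [c] with those giving [u] the colour of [v]. *)
Lemma card_colourings_fixed A u v (c : 'I_q) : ~~ conn e1 e2 A u v ->
  #|[pred sigma : {ffun V -> 'I_q} | (A \subset mono_edges e1 e2 sigma)
                  && (sigma u == c)]| =
  #|[pred sigma : {ffun V -> 'I_q} | (A \subset mono_edges e1 e2 sigma)
                  && (sigma u == sigma v)]|.
Proof.
move=> /negPf nuv; have uu : conn e1 e2 A u u by exact: connect0.
rewrite -!sum1_card /=.
rewrite (reindex_onto (fun tau => recolour A u c tau)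
                      (fun sigma => recolour A u (sigma v) sigma)) /=; last first.
  by move=> sigma /andP[mono /eqP <-]; rewrite recolourK recolour_id.
apply: eq_bigl => tau; rewrite !inE recolourK !ffunE uu nuv eqxx andbT.
apply/andP/andP => [[mono /eqP tauE]|[mono /eqP uv]].
  split; last by rewrite -{1}tauE ffunE uu.
  by rewrite -tauE -(recolourK A u _ c); exact: recolour_mono.
by rewrite recolour_mono // -uv recolour_id.
Qed.

(** This is the source of the rate p/q in the single-bond dynamics: two unconnected vertices agree
    in exactly one out of q compatible colourings. *)
Lemma card_colourings_split A u v : ~~ conn e1 e2 A u v ->
  #|[pred sigma : {ffun V -> 'I_q} | A \subset mono_edges e1 e2 sigma]| =
  (q * #|[pred sigma : {ffun V -> 'I_q} | (A \subset mono_edges e1 e2 sigma)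
                       && (sigma u == sigma v)]|)%N.
Proof.
move=> nuv; rewrite -[LHS]sum1_card.
rewrite (partition_big (fun sigma => sigma u) predT) //=.
rewrite (eq_bigr (fun=> #|[pred sigma : {ffun V -> 'I_q} |
                       (A \subset mono_edges e1 e2 sigma)
                       && (sigma u == sigma v)]|)).
  by rewrite sum_nat_const card_ord.
by move=> c _; rewrite sum1_card; exact: card_colourings_fixed.
Qed.

End Colourings.

(** * Dirichlet forms of the two dynamics *)

Section RandomCluster.
Variables (R : realType) (V E : finType) (e1 e2 : E -> V) (p : R) (q : nat).
Hypotheses (p01 : 0 < p < 1) (q_gt0 : (0 < q)%N) (E_gt0 : (0 < #|E|)%N).
Implicit Types (A B : {set E}) (sigma : {ffun V -> 'I_q}) (f g : {set E} -> R).

Let odds : R := p / (1 - p).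
Local Notation mono := (mono_edges e1 e2).
Local Notation m := (#|E|%:R : R).

Definition rc_weight A : R := odds ^+ #|A| * q%:R ^+ ncomp e1 e2 A.
(** Probability 0 off E(sigma) puts the measures of all colourings on the same space of edge
    sets. *)
Definition edge_prob sigma e : R := if e \in mono sigma then p else 0.
(** The total mass of [odds ^+ #|A|] over A inside E(sigma), since 1 + p/(1-p) = 1/(1-p); thus the
    unnormalised colour marginal of the coupling. *)
Definition colour_weight sigma : R := (1 - p) ^- #|mono sigma|.

Local Notation Z := colour_weight.
Local Notation dot sigma := (wdot (bernoulli R E (edge_prob sigma))).
Local Notation T sigma := (resample R E (edge_prob sigma)).
Local Notation SW := (P_SW e1 e2 p q).
Local Notation SB := (P_SB e1 e2 p q).

Let p_gt0 : 0 < p. Proof. by case/andP: p01. Qed.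
Let p_lt1 : 0 < 1 - p. Proof. by case/andP: p01; rewrite subr_gt0. Qed.
Let odds_gt0 : 0 < odds. Proof. exact: divr_gt0. Qed.
Let q_neq0 : q%:R != 0 :> R. Proof. by rewrite pnatr_eq0 -lt0n. Qed.
Let m_gt0 : 0 < m. Proof. by rewrite ltr0n. Qed.

Lemma edge_prob01 sigma e : 0 <= edge_prob sigma e <= 1.
Proof.
rewrite /edge_prob; case: ifP => _; rewrite ?lexx ?ler01 //.
by rewrite (ltW p_gt0) -subr_ge0 ltW.
Qed.

Lemma rc_weight_gt0 A : 0 < rc_weight A.
Proof. by rewrite mulr_gt0 ?exprn_gt0 ?ltr0n. Qed.

Lemma colour_weight_gt0 sigma : 0 < Z sigma.
Proof. by rewrite invr_gt0 exprn_gt0. Qed.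

Lemma bernoulli_edge_prob sigma A :
  bernoulli R E (edge_prob sigma) A =
  (A \subset mono sigma)%:R * odds ^+ #|A| * (1 - p) ^+ #|mono sigma|.
Proof.
rewrite /bernoulli; case: (boolP (A \subset _)) => [/fintype.subsetP sub|].
  rewrite mul1r -!prodr_const (big_mkcond (mem A)) (big_mkcond (mem (mono sigma))).
  rewrite -big_split; apply: eq_bigr => e _ /=; rewrite /edge_prob.
  case: ifP => [/sub ->|_]; first by rewrite /odds divfK ?gt_eqF.
  by case: ifP; rewrite mul1r ?subr0.
case/subsetPn => e eA enF; rewrite !mul0r (bigD1 e) //= eA /edge_prob (negPf enF).
by rewrite mul0r.
Qed.

Lemma colour_weight_bernoulli sigma A :
  Z sigma * bernoulli R E (edge_prob sigma) A =
  (A \subset mono sigma)%:R * odds ^+ #|A|.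
Proof.
by rewrite bernoulli_edge_prob mulrCA [Z _ * _]mulVf ?mulr1 // expf_neq0 // gt_eqF.
Qed.

Lemma sumr_card (U : finType) (P : pred U) :
  \sum_x (P x)%:R = #|[pred x | P x]|%:R :> R.
Proof.
rewrite -sum1_card natr_sum [RHS]big_mkcond; apply: eq_bigr => x _.
by rewrite inE; case: (P x).
Qed.

Lemma sum_edges_cst x : \sum_(e : E) x = m * x.
Proof. by rewrite big_const iter_addr_0 mulr_natl. Qed.

Lemma rc_weightE A :
  rc_weight A = \sum_(sigma : {ffun V -> 'I_q})
    (A \subset mono sigma)%:R * odds ^+ #|A|.
Proof.
rewrite -mulr_suml sumr_card (card_colourings V E e1 e2 q) natrX.
by rewrite mulrC.
Qed.

(* The random-cluster measure is the [A]-marginal of the Edwards-Sokal coupling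
   of colourings and edge sets. *)
Lemma wdot_rc_weight f g :
  wdot rc_weight f g = \sum_sigma Z sigma * dot sigma f g.
Proof.
under [RHS]eq_bigr do rewrite mulr_sumr.
rewrite exchange_big; apply: eq_bigr => A _ /=; rewrite rc_weightE mulr_suml.
by apply: eq_bigr => sigma _; rewrite [RHS]mulrA colour_weight_bernoulli.
Qed.

(** The factor q^(-c(A)) of the kernel cancels the one in [rc_weight]. For fixed sigma the remaining
    weight factors into a part in A and a part in B, so each colouring contributes a product of
    means. *)
Lemma swendsen_wang_form f g :
  wdot rc_weight f (act SW g) =
  \sum_sigma Z sigma * (dot sigma (fun=> 1) f * dot sigma (fun=> 1) g).
Proof.
transitivity (\sum_A \sum_sigma
    (Z sigma * (bernoulli R E (edge_prob sigma) A * f A)) *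
    dot sigma (fun=> 1) g).
  apply: eq_bigr => A _; rewrite /act !mulr_sumr /wdot.
  under [RHS]eq_bigr do rewrite mulr_sumr.
  rewrite exchange_big; apply: eq_bigr => B _ /=.
  rewrite /P_SW !mulrA !mulr_sumr !mulr_suml.
  apply: eq_bigr => sigma _; rewrite finset.subUset !mulrA colour_weight_bernoulli.
  rewrite bernoulli_edge_prob /rc_weight -/odds.
  have qc : (q%:R ^+ ncomp e1 e2 A : R) != 0 by rewrite expf_neq0.
  case: (A \subset _); case: (B \subset _) => /=; field; exact: qc.
rewrite exchange_big; apply: eq_bigr => sigma _ /=.
rewrite -mulr_suml -mulr_sumr mulrA; congr (_ * _ * _).
by apply: eq_bigr => A _; rewrite mul1r.
Qed.

Lemma sum_g_e e A g :
  \sum_B g_e e1 e2 p q e A B * g B =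
  let c := if conn e1 e2 A (e1 e) (e2 e) then p else p / q%:R in
  c * g (e |: A) + (1 - c) * g (A :\ e).
Proof.
have ne : A :\ e != e |: A.
  by apply/eqP => /setP/(_ e); rewrite !inE eqxx.
rewrite (bigD1 (e |: A)) // (bigD1 (A :\ e)) //= big1 ?addr0.
  by rewrite /g_e eqxx (negPf ne) eqxx; case: ifP.
move=> B /andP[/negPf BU /negPf BD].
by rewrite /g_e BU BD !if_same mul0r.
Qed.

(** If A joins the ends of [e], every compatible colouring makes [e] monochromatic and T_e uses p.
    Otherwise only a share 1/q of them does, and T_e, being affine in its probability, averages to
    the rate p/q. *)
Lemma sum_g_e_colourings e A g :
  rc_weight A * (\sum_B g_e e1 e2 p q e A B * g B) =
  \sum_sigma (A \subset mono sigma)%:R * odds ^+ #|A| * T sigma e g A.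
Proof.
rewrite sum_g_e; case: (boolP (conn _ _ _ _ _)) => [eA|neA] /=.
  rewrite rc_weightE mulr_suml; apply: eq_bigr => sigma _.
  case: (boolP (A \subset _)) => [/mono_edgesP sub|]; last by rewrite !mul0r.
  by rewrite /resample /edge_prob inE (sub _ _ eA) eqxx.
under eq_bigr => sigma _.
  have -> : (A \subset mono sigma)%:R * odds ^+ #|A| * T sigma e g A =
      (A \subset mono sigma)%:R * (odds ^+ #|A| * g (A :\ e)) +
      ((A \subset mono sigma) && (sigma (e1 e) == sigma (e2 e)))%:R *
      (odds ^+ #|A| * p * (g (e |: A) - g (A :\ e))).
    rewrite /resample /edge_prob inE.
    by case: (A \subset _); case: (_ == _) => /=; ring.
  over.
rewrite big_split /= -!mulr_suml !sumr_card /rc_weight -natrX.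
rewrite -(card_colourings V E e1 e2 q) (card_colourings_split V E e1 e2 q A _ _ neA).
by rewrite natrM; field.
Qed.

Lemma single_bond_form f g :
  wdot rc_weight f (act SB g) =
  \sum_sigma Z sigma * (m^-1 * \sum_e dot sigma f (T sigma e g)).
Proof.
transitivity (m^-1 * \sum_A \sum_e
    f A * (rc_weight A * \sum_B g_e e1 e2 p q e A B * g B)).
  rewrite mulr_sumr; apply: eq_bigr => A _; rewrite -!mulr_sumr.
  have -> : act SB g A = m^-1 * \sum_e \sum_B g_e e1 e2 p q e A B * g B.
    rewrite /act exchange_big mulr_sumr; apply: eq_bigr => B _ /=.
    by rewrite /P_SB -mulrA mulr_suml.
  ring.
under [RHS]eq_bigr do rewrite mulrCA.
rewrite -mulr_sumr; congr (_ * _); rewrite exchange_big.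
under [RHS]eq_bigr do rewrite mulr_sumr.
rewrite [RHS]exchange_big; apply: eq_bigr => e _ /=.
under [RHS]eq_bigr do rewrite mulr_sumr.
rewrite [RHS]exchange_big; apply: eq_bigr => A _ /=.
rewrite sum_g_e_colourings mulr_sumr; apply: eq_bigr => sigma _.
by rewrite [RHS]mulrA colour_weight_bernoulli; ring.
Qed.

(** * Reversibility, row sums and comparison of the forms *)

Lemma kreversible_SW : kreversible rc_weight SW.
Proof.
move=> f g; rewrite [RHS]wdotC !swendsen_wang_form.
by apply: eq_bigr => sigma _; rewrite [dot _ _ f * _]mulrC.
Qed.

Lemma kreversible_SB : kreversible rc_weight SB.
Proof.
move=> f g; rewrite [RHS]wdotC !single_bond_form.
apply: eq_bigr => sigma _; congr (_ * (_ * _)).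
by apply: eq_bigr => e _; rewrite resampleC wdotC.
Qed.

(** Testing against the indicator of [A] isolates the row of [A], so row sums also follow from the
    formulas for the forms. *)
Lemma row_sum_of_form (P : {set E} -> {set E} -> R) :
  (forall f, wdot rc_weight f (act P (fun=> 1)) = wdot rc_weight f (fun=> 1)) ->
  forall A, \sum_B P A B = 1.
Proof.
move=> P1 A; have := P1 (fun B => (B == A)%:R); rewrite !wdot_deltal.
move=> /(mulfI (lt0r_neq0 (rc_weight_gt0 A))) <-.
by apply: eq_bigr => B _; rewrite mulr1.
Qed.

Lemma row_sum_SW A : \sum_B SW A B = 1.
Proof.
apply: row_sum_of_form => f; rewrite swendsen_wang_form wdot_rc_weight.
apply: eq_bigr => sigma _; congr (_ * _).
have -> : dot sigma (fun=> 1) (fun=> 1) = 1.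
  by rewrite /wdot -mulr_suml bernoulli_sum !mulr1.
by rewrite mulr1 wdotC.
Qed.

Lemma row_sum_SB A : \sum_B SB A B = 1.
Proof.
apply: row_sum_of_form => f; rewrite single_bond_form wdot_rc_weight.
apply: eq_bigr => sigma _; congr (_ * _).
rewrite (eq_bigr (fun=> dot sigma f (fun=> 1))); last first.
  by move=> e _; rewrite resample1.
by rewrite sum_edges_cst mulKf ?gt_eqF.
Qed.

Lemma SB_bounds f :
  0 <= wdot rc_weight f (act SB f) <= wdot rc_weight f f.
Proof.
have Tb sigma e := wdot_resample_bounds R E _ (edge_prob01 sigma) e f.
rewrite single_bond_form wdot_rc_weight; apply/andP; split.
  apply: sumr_ge0 => sigma _; apply: mulr_ge0; first exact/ltW/colour_weight_gt0.
  apply: mulr_ge0; first by rewrite invr_ge0 ltW.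
  by apply: sumr_ge0 => e _; case/andP: (Tb sigma e).
apply: ler_sum => sigma _; rewrite ler_pM2l ?colour_weight_gt0 //.
rewrite mulrC ler_pdivrMr // mulrC -sum_edges_cst.
by apply: ler_sum => e _; case/andP: (Tb sigma e).
Qed.

Lemma SW_le_SB f :
  wdot rc_weight f (act SW f) <= wdot rc_weight f (act SB f).
Proof.
rewrite single_bond_form swendsen_wang_form.
apply: ler_sum => sigma _; rewrite ler_pM2l ?colour_weight_gt0 //.
rewrite [leRHS]mulrC ler_pdivlMr // mulrC -sum_edges_cst -expr2.
by apply: ler_sum => e _; apply: resample_jensen => e'; exact: edge_prob01.
Qed.

Lemma SW_ge0 f : 0 <= wdot rc_weight f (act SW f).
Proof.
rewrite swendsen_wang_form; apply: sumr_ge0 => sigma _.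
by rewrite mulr_ge0 -?expr2 ?sqr_ge0 // ltW ?colour_weight_gt0.
Qed.

(** Efron-Stein colouring by colouring. It bounds the variance by a sum over edges, whereas
    single-bond takes the average: hence the factor m. *)
Lemma SW_dirichlet_le f :
  wdot rc_weight f f - wdot rc_weight f (act SW f) <=
  m * (wdot rc_weight f f - wdot rc_weight f (act SB f)).
Proof.
rewrite single_bond_form swendsen_wang_form wdot_rc_weight -!sumrB mulr_sumr.
apply: ler_sum => sigma _; rewrite -!mulrBr mulrCA ler_pM2l ?colour_weight_gt0 //.
rewrite mulrBr mulrA mulfV ?gt_eqF // mul1r -expr2 -sum_edges_cst -sumrB.
by apply: efron_stein => e; exact: edge_prob01.
Qed.

(** Equality forces every nonnegative defect to vanish. For a constant colouring all edges are
    monochromatic and the Bernoulli measure charges every edge set, so f is fixed by each T_e, hence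
    constant, hence 0 by orthogonality. *)
Lemma SB_irreducible f : wdot rc_weight (fun=> 1) f = 0 ->
  wdot rc_weight f (act SB f) = wdot rc_weight f f -> wdot rc_weight f f = 0.
Proof.
move=> f1 ff.
pose sigma0 : {ffun V -> 'I_q} := [ffun=> Ordinal q_gt0].
have in0 e : e \in mono sigma0 by rewrite inE !ffunE.
have b0 A : 0 < bernoulli R E (edge_prob sigma0) A.
  have -> : bernoulli R E (edge_prob sigma0) A =
      odds ^+ #|A| * (1 - p) ^+ #|mono sigma0|.
    rewrite bernoulli_edge_prob; suff -> : A \subset mono sigma0 by rewrite mul1r.
    by apply/fintype.subsetP => e _.
  by rewrite mulr_gt0 ?exprn_gt0.
have Tb sigma e := wdot_resample_bounds R E _ (edge_prob01 sigma) e f.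
have defect0 sigma e : dot sigma f f - dot sigma f (T sigma e f) = 0.
  have s0 tau : 0 <= \sum_e (dot tau f f - dot tau f (T tau e f)).
    by apply: sumr_ge0 => e' _; rewrite subr_ge0; case/andP: (Tb tau e').
  have total : \sum_sigma Z sigma * (m^-1 * \sum_e
      (dot sigma f f - dot sigma f (T sigma e f))) = 0.
    rewrite -[RHS](subrr (wdot rc_weight f f)) -[in X in _ - X]ff.
    rewrite single_bond_form wdot_rc_weight -sumrB; apply: eq_bigr => tau _.
    by rewrite sumrB sum_edges_cst mulrBr mulKf ?gt_eqF // mulrBr.
  have t0 tau : true ->
      0 <= Z tau * (m^-1 * \sum_e (dot tau f f - dot tau f (T tau e f))).
    by move=> _; rewrite pmulr_rge0 ?colour_weight_gt0 // pmulr_rge0 ?invr_gt0.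
  have /eqP := psumr_eq0P t0 total (i := sigma) isT.
  rewrite mulf_eq0 (gt_eqF (colour_weight_gt0 sigma)) /=.
  rewrite mulf_eq0 invr_eq0 (gt_eqF m_gt0) /=.
  move=> /eqP sum0; apply: (psumr_eq0P _ sum0 (i := e)) => // e' _.
  by rewrite subr_ge0; case/andP: (Tb sigma e').
have fU e A : f (e |: A) = f A.
  have TE B : f B = T sigma0 e f B.
    have := defect0 sigma0 e; rewrite resample_defect => /(wdot_eq0 _ _ _ _ b0)/(_ B).
    by rewrite mulN1r => /subr0_eq.
  by rewrite TE resample_setU1 -TE.
have fc : f = fun=> f finset.set0 by apply/funext; exact: setU1_invariant_cst.
move: f1; rewrite fc /wdot; set c := f _ => f1.
transitivity (c * \sum_A rc_weight A * (1 * c)); last by rewrite f1 mulr0.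
by rewrite mulr_sumr; apply: eq_bigr => A _; ring.
Qed.

End RandomCluster.

(** * The two gap inequalities *)

Theorem theorem4p8 (R : realType) (V E : finType) (e1 e2 : E -> V)
  (p : R) (q : nat) :
  (3 <= #|E|)%N -> 0 < p < 1 -> (0 < q)%N ->
  spectral_gap (P_SB e1 e2 p q) <= spectral_gap (P_SW e1 e2 p q) /\
  spectral_gap (P_SW e1 e2 p q)
    <= 8 * #|E|%:R * ln (#|E|%:R : R) * spectral_gap (P_SB e1 e2 p q).
Proof.
move=> E3 p01 q0; have E0 : (0 < #|E|)%N by exact: leq_trans E3.
have w0 := rc_weight_gt0 R V E e1 e2 p q p01 q0.
have revW := kreversible_SW R V E e1 e2 p q p01 q0.
have revB := kreversible_SB R V E e1 e2 p q p01 q0.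
have sumW := row_sum_SW R V E e1 e2 p q p01 q0.
have sumB := row_sum_SB R V E e1 e2 p q p01 q0 E0.
have boundB := SB_bounds R V E e1 e2 p q p01 q0 E0.
have SWB := SW_le_SB R V E e1 e2 p q p01 q0 E0.
have W0 := SW_ge0 R V E e1 e2 p q p01 q0.
have irrB := SB_irreducible R V E e1 e2 p q p01 q0 E0.
have B0 f := proj1 (andP (boundB f)).
have m3 : 3 <= #|E|%:R :> R by rewrite (ler_nat R 3).
split.
  rewrite -[leRHS]mul1r; apply: (gap_comparison _ _ _ w0) => // f.
  by rewrite mul1r lerD2l lerN2.
have gapB0 : 0 <= spectral_gap (P_SB e1 e2 p q).
  (* compare the chain with itself, with a wasteful constant *)
  suff : spectral_gap (P_SB e1 e2 p q) <= 2 * spectral_gap (P_SB e1 e2 p q) by lra.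
  apply: (gap_comparison _ _ _ w0) => // [|f]; first by lra.
  by case/andP: (boundB f); lra.
apply: (@le_trans _ _ (#|E|%:R * spectral_gap (P_SB e1 e2 p q))).
  apply: (gap_comparison _ _ _ w0) => //.
  - by move=> f; rewrite W0 (le_trans (SWB f)) //; case/andP: (boundB f).
  (* Irreducibility passes from single-bond to Swendsen-Wang, because <f, SW f> <= <f, SB f> <= <f,
     f>. *)
  - move=> f f1 Wf; apply: irrB => //; apply/eqP; rewrite eq_le.
    by case/andP: (boundB f) => _ -> /=; rewrite -Wf.
  - by lra.
  - exact: (SW_dirichlet_le R V E e1 e2 p q p01 q0 E0).
apply: ler_wpM2r => //.
(* This is ln(1 + x) <= x at x = 1/m - 1. For m >= 3 it gives ln m >= 2/3, so m <= 8 m ln m. *)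
have ln_m : 1 - (#|E|%:R)^-1 <= ln (#|E|%:R : R).
  have i0 : 0 < (#|E|%:R : R)^-1 by rewrite invr_gt0; lra.
  have : ln (1 + ((#|E|%:R : R)^-1 - 1)) <= (#|E|%:R)^-1 - 1 by apply: le_ln1Dx; lra.
  by rewrite addrCA subrr addr0 lnV ?posrE; lra.
have : (#|E|%:R : R)^-1 <= 1 / 3 by rewrite div1r lef_pV2 ?posrE //; lra.
nra.
Qed.
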